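(* The emptiness problem for multicounter automata (deciding whether a given MCA has an accepting run) is computably many-one reducible to the finite satisfiability problem for $\mathrm{C}^2( *,1,\{<\})$; i.e. the latter problem is at least as hard as the former.
   Context: A multicounter automaton (MCA) is a tuple $\langle Q,C,R,\delta,q_I,F\rangle$ with finite state set $Q$, initial state $q_I$, final states $F\subseteq Q$, finite set of counters $C$, $R\subseteq C$, and $\delta\subseteq Q\times\{inc(c),dec(c),skip: c\in C\}\times Q$. Configurations are pairs $\langle p,\vec n\rangle$, $\vec n\in\mathbb{N}^C$; $inc(c)$ increments counter $c$, $dec(c)$ is applicable only when counter $c$ is positive and decrements it, skip changes no counter; the state changes from $p$ to $q$. An accepting run starts at $\langle q_I,\vec 0\rangle$ and ends in $\langle q_F,\vec n_F\rangle$ with $q_F\in F$ and $\vec n_F(c)=0$ for $c\in R$. $\mathrm{C}^2$ is the two-variable fragment of first-order logic with counting quantifiers $\exists^{<k},\exists^{\le k},\exists^{=k},\exists^{\ge k},\exists^{>k}$. $\mathrm{C}^2( *,1,\{<\})$ denotes $\mathrm{C}^2$ sentences over a relational signature with arbitrarily many unary predicates, at most one binary predicate besides the distinguished symbol $<$, where $<$ is interpreted as a strict linear order; finite satisfiability asks for a finite model. *)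

(* Defs.v *)
From HB Require Import structures.
From mathcomp Require Import all_boot all_order.

Set Implicit Arguments.
Unset Strict Implicit.
Unset Printing Implicit Defensive.

(** * Total recursive functions and many-one reductions *)

(* The least class of total functions nat^k -> nat that contains zero,
   successor and the projections and is closed under composition, primitive
   recursion and minimisation of regular functions.  In [rec_min] the
   hypothesis on [f] says that [f v] is the least zero of [y |-> g (y, v)], so
   [g] is regular.  By Kleene's normal form theorem these are exactly the total
   Turing-computable functions. *)
Inductive recursive : forall k, (k.-tuple nat -> nat) -> Prop :=
| rec_zero : @recursive 0 (fun=> 0)
| rec_succ : @recursive 1 (fun v => (thead v).+1)
| rec_proj k (i : 'I_k) : recursive (fun v : k.-tuple nat => tnth v i)
| rec_comp k m (g : m.-tuple nat -> nat) (h : 'I_m -> k.-tuple nat -> nat) :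
    recursive g -> (forall i, recursive (h i)) ->
    recursive (fun v => g [tuple h i v | i < m])
| rec_prim k (g : k.-tuple nat -> nat) (h : k.+2.-tuple nat -> nat) :
    recursive g -> recursive h ->
    recursive (fun v : k.+1.-tuple nat =>
      iteri (thead v) (fun i r => h [tuple of i :: r :: behead v])
            (g [tuple of behead v]))
| rec_min k (g : k.+1.-tuple nat -> nat) (f : k.-tuple nat -> nat) :
    recursive g ->
    (forall v, g [tuple of f v :: v] = 0 /\
               forall y, y < f v -> g [tuple of y :: v] <> 0) ->
    recursive f
| rec_ext k (f g : k.-tuple nat -> nat) :
    recursive f -> f =1 g -> recursive g.

(* A decision problem is given by its type of instances, a Goedel numbering of
   the instances, and the property to be decided. *)
Definition computable (X Y : Type) (codeX : X -> nat) (codeY : Y -> nat)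
    (f : X -> Y) : Prop :=
  exists2 g : 1.-tuple nat -> nat,
    recursive g & forall x, g [tuple codeX x] = codeY (f x).

Definition many_one_reducible (X Y : Type) (codeX : X -> nat)
    (codeY : Y -> nat) (P : X -> Prop) (Q : Y -> Prop) : Prop :=
  exists2 f : X -> Y,
    computable codeX codeY f & forall x, P x <-> Q (f x).

(** * Multicounter automata *)

Inductive op (C : Type) : Type := Inc of C | Dec of C | Skip.
Arguments Skip {C}.

Definition sum_of_op (C : Type) (o : op C) : C + C + unit :=
  match o with
  | Inc c => inl (inl c)
  | Dec c => inl (inr c)
  | Skip => inr tt
  end.

Definition op_of_sum (C : Type) (s : C + C + unit) : op C :=
  match s with
  | inl (inl c) => Inc c
  | inl (inr c) => Dec c
  | inr _ => Skip
  end.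

Lemma sum_of_opK (C : Type) : cancel (@sum_of_op C) (@op_of_sum C).
Proof. by case. Qed.

HB.instance Definition _ (C : finType) :=
  Finite.copy (op C) (can_type (@sum_of_opK C)).

Record mca (Q C : finType) : Type := MCA {
  zero_tested : {set C};            (* the set R *)
  delta : {set Q * op C * Q};
  init : Q;
  final : {set Q}
}.

Definition config (Q C : finType) : Type := (Q * {ffun C -> nat})%type.

Definition op_step (C : finType) (o : op C) (n n' : {ffun C -> nat}) : bool :=
  match o with
  | Inc c => n' == [ffun d => if d == c then (n d).+1 else n d]
  | Dec c => (0 < n c) && (n' == [ffun d => if d == c then (n d).-1 else n d])
  | Skip => n' == n
  end.

Definition step (Q C : finType) (A : mca Q C) (s t : config Q C) : bool :=
  [exists o : op C, ((s.1, o, t.1) \in delta A) && op_step o s.2 t.2].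

Definition init_config (Q C : finType) (A : mca Q C) : config Q C :=
  (init A, [ffun=> 0]).

Definition accepting (Q C : finType) (A : mca Q C) (s : config Q C) : bool :=
  (s.1 \in final A) && [forall c in zero_tested A, s.2 c == 0].

Definition has_accepting_run (Q C : finType) (A : mca Q C) : Prop :=
  exists s : seq (config Q C),
    path (step A) (init_config A) s /\ accepting A (last (init_config A) s).

(* To be inputs of an algorithm, automata are presented with
   Q = {0, ..., nstates - 1} and C = {0, ..., ncounters - 1}. *)
Record mca_input : Type := MCAInput {
  nstates : nat;
  ncounters : nat;
  automaton : mca 'I_nstates 'I_ncounters
}.

Definition mca_nonempty (A : mca_input) : Prop :=
  has_accepting_run (automaton A).

Definition op_code m (o : op 'I_m) : nat :=
  match o with
  | Inc c => CodeSeq.code [:: 0; val c]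
  | Dec c => CodeSeq.code [:: 1; val c]
  | Skip => CodeSeq.code [:: 2]
  end.

Definition trans_code n m (t : 'I_n * op 'I_m * 'I_n) : nat :=
  CodeSeq.code [:: val t.1.1; op_code t.1.2; val t.2].

Definition mca_code (A : mca_input) : nat :=
  let B := automaton A in
  CodeSeq.code
    [:: nstates A; ncounters A;
        CodeSeq.code [seq val c | c <- enum (zero_tested B)];
        CodeSeq.code [seq trans_code t | t <- enum (delta B)];
        val (init B);
        CodeSeq.code [seq val q | q <- enum (final B)]].

(** * The logic C^2 with one binary predicate and a linear order *)

Inductive comparison : Type := CLt | CLe | CEq | CGe | CGt.

Definition compare (c : comparison) (n k : nat) : bool :=
  match c with
  | CLt => n < k
  | CLe => n <= k
  | CEq => n == k
  | CGe => n >= k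
  | CGt => n > k
  end.

(* The two variables are the elements of 'I_2.  The unary predicate symbols are
   indexed by nat; [Binary] is the only binary predicate symbol besides the
   order symbol and equality. *)
Inductive formula : Type :=
| Unary (p : nat) (u : 'I_2)
| Binary (u v : 'I_2)
| Less (u v : 'I_2)
| Equal (u v : 'I_2)
| Not (f : formula)
| And (f g : formula)
| Or (f g : formula)
| Forall (u : 'I_2) (f : formula)
| Exists (u : 'I_2) (f : formula)
| Count (c : comparison) (k : nat) (u : 'I_2) (f : formula).

Fixpoint free (w : 'I_2) (f : formula) : bool :=
  match f with
  | Unary _ u => w == u
  | Binary u v | Less u v | Equal u v => (w == u) || (w == v)
  | Not f => free w f
  | And f g | Or f g => free w f || free w g
  | Forall u f | Exists u f | Count _ _ u f => (w != u) && free w f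
  end.

Definition closed (f : formula) : bool := [forall w, ~~ free w f].

Definition sentence : Type := {f : formula | closed f}.

Record structure : Type := Structure {
  disp : Order.disp_t;
  dom : finOrderType disp;
  dom_nonempty : 0 < #|dom|;
  unary : nat -> pred dom;
  binary : rel dom
}.

Fixpoint holds (M : structure) (f : formula) (e : 'I_2 -> dom M) : bool :=
  match f with
  | Unary p u => unary p (e u)
  | Binary u v => binary (e u) (e v)
  | Less u v => (e u < e v)%O
  | Equal u v => e u == e v
  | Not f => ~~ holds f e
  | And f g => holds f e && holds g e
  | Or f g => holds f e || holds g e
  | Forall u f => [forall a, holds f [eta e with u |-> a]]
  | Exists u f => [exists a, holds f [eta e with u |-> a]]
  | Count c k u f => compare c #|[pred a | holds f [eta e with u |-> a]]| k
  end.

Definition finitely_satisfiable (phi : sentence) : Prop :=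
  exists M : structure, forall e : 'I_2 -> dom M, holds (val phi) e.

Definition comparison_code (c : comparison) : nat :=
  match c with CLt => 0 | CLe => 1 | CEq => 2 | CGe => 3 | CGt => 4 end.

Fixpoint formula_code (f : formula) : nat :=
  match f with
  | Unary p u => CodeSeq.code [:: 0; p; val u]
  | Binary u v => CodeSeq.code [:: 1; val u; val v]
  | Less u v => CodeSeq.code [:: 2; val u; val v]
  | Equal u v => CodeSeq.code [:: 3; val u; val v]
  | Not f => CodeSeq.code [:: 4; formula_code f]
  | And f g => CodeSeq.code [:: 5; formula_code f; formula_code g]
  | Or f g => CodeSeq.code [:: 6; formula_code f; formula_code g]
  | Forall u f => CodeSeq.code [:: 7; val u; formula_code f]
  | Exists u f => CodeSeq.code [:: 8; val u; formula_code f]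
  | Count c k u f =>
      CodeSeq.code [:: 9; comparison_code c; k; val u; formula_code f]
  end.

Definition sentence_code (phi : sentence) : nat := formula_code (val phi).

(** * The Goedel numberings are injective *)

Lemma code_inj : injective CodeSeq.code.
Proof. exact: can_inj CodeSeq.codeK. Qed.

Lemma comparison_code_inj : injective comparison_code.
Proof. by case=> [] []. Qed.

Lemma formula_code_inj : injective formula_code.
Proof.
elim=> [p u|u v|u v|u v|f IHf|f IHf g IHg|f IHf g IHg|u f IHf|u f IHf
       |c k u f IHf] [p' u'|u' v'|u' v'|u' v'|f'|f' g'|f' g'|u' f'|u' f'
       |c' k' u' f'];
  cbn [formula_code] => /code_inj //; case.
- by move=> -> /val_inj ->.
- by move=> /val_inj -> /val_inj ->.
- by move=> /val_inj -> /val_inj ->.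
- by move=> /val_inj -> /val_inj ->.
- by move=> /IHf ->.
- by move=> /IHf -> /IHg ->.
- by move=> /IHf -> /IHg ->.
- by move=> /val_inj -> /IHf ->.
- by move=> /val_inj -> /IHf ->.
- by move=> /comparison_code_inj -> -> /val_inj -> /IHf ->.
Qed.

Lemma sentence_code_inj : injective sentence_code.
Proof. by move=> phi psi /formula_code_inj /val_inj. Qed.

Lemma op_code_inj m : injective (@op_code m).
Proof. by move=> [c|c|] [d|d|] /code_inj //; case=> /val_inj ->. Qed.

Lemma trans_code_inj n m : injective (@trans_code n m).
Proof.
move=> [[p o] q] [[p' o'] q'] /code_inj [].
by move=> /val_inj -> /op_code_inj -> /val_inj ->.
Qed.

Lemma enum_set_inj (T : finType) (A B : {set T}) : enum A = enum B -> A = B.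
Proof. by move=> eAB; apply/setP=> x; rewrite -mem_enum eAB mem_enum. Qed.

Lemma mca_code_inj : injective mca_code.
Proof.
move=> [n m [R d i F]] [n' m' [R' d' i' F']] /code_inj; case=> en em.
subst n' m' => /code_inj /(inj_map val_inj) /enum_set_inj ->.
move=> /code_inj /(inj_map (@trans_code_inj n m)) /enum_set_inj ->.
by move=> /val_inj -> /code_inj /(inj_map val_inj) /enum_set_inj ->.
Qed.

(* Main.v *)
(* Let a run of the automaton be a finite chain whose elements are its
   configurations.  Unary predicates name the state of each element and the
   operation performed there.  The single binary predicate E serves twice: an
   edge from an element down to a smaller one means "successor of", and an edge
   upwards matches an increment of a counter with a later decrement of the same
   counter.

   The successor relation is not definable from the order with two variables,
   but it is forced by counting: if every non-minimal x has an E-edge to some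
   y < x, and every y receives at most one edge from above, then the edges form
   an injection x |-> y < x of the non-minimal elements, and on a finite chain
   the only such injection is the predecessor map.

   A run never decrements an empty counter exactly when the decrements of each
   counter can be matched injectively with earlier increments; a tested counter
   ends at zero exactly when, moreover, every increment is matched.  Given a
   run, the first-in first-out matching works: the k-th increment is matched
   with the k-th decrement.

   The reduction is a function of the code of the automaton alone, so it is
   computed by loops over the lists of numbers stored in that code. *)

Require Import Defs.
From mathcomp Require Import all_boot all_order.
From mathcomp Require Import zify.

Set Implicit Arguments.
Unset Strict Implicit.
Unset Printing Implicit Defensive.

Import Order.TTheory.

(** * Recursive functions on sequences *)

(* Sequences instead of tuples: an environment is extended with [cons] and shrunk
   with [behead] without casts.  Only its values at length k matter. *)
Definition rf (k : nat) (f : seq nat -> nat) : Prop :=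
  recursive (fun v : k.-tuple nat => f v).

Lemma rf_ext k (f g : seq nat -> nat) : f =1 g -> rf k f -> rf k g.
Proof. by move=> fg rff; apply: rec_ext rff _ => v; rewrite fg. Qed.

Lemma rf_var k i : i < k -> rf k (nth 0 ^~ i).
Proof.
move=> ik; apply: rec_ext (rec_proj (Ordinal ik)) _ => v.
by rewrite /thead (tnth_nth 0).
Qed.

Lemma rf_comp k g (hs : seq (seq nat -> nat)) :
  rf (size hs) g -> (forall i, i < size hs -> rf k (nth (fun=> 0) hs i)) ->
  rf k (fun s => g [seq h s | h <- hs]).
Proof.
move=> rfg rfh.
apply: rec_ext (rec_comp rfg (fun i => rfh (val i) (ltn_ord i))) _ => v /=.
congr g.
rewrite -[in RHS](mkseq_nth (fun=> 0) hs) /mkseq -map_comp -val_enum_ord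
  -map_comp.
by apply: eq_map.
Qed.

Lemma rf_op1 k (op : nat -> nat) a :
  rf 1 (fun s => op (nth 0 s 0)) -> rf k a -> rf k (fun s => op (a s)).
Proof. by move=> rfop rfa; apply: (rf_comp (hs := [:: a]) rfop) => [[]]. Qed.

Lemma rf_behead k f : rf k f -> rf k.+1 (fun s => f (behead s)).
Proof.
move=> rff; apply: rec_ext
  (rec_comp rff (fun i : 'I_k => rec_proj (lift ord0 i))) _ => v /=.
congr f; apply: (@eq_from_nth _ 0).
  by rewrite size_map size_enum_ord size_behead size_tuple.
move=> i; rewrite size_map size_enum_ord => ik.
rewrite (nth_map (Ordinal ik)) ?size_enum_ord // (tnth_nth 0) nth_behead /=.
by rewrite nth_enum_ord.
Qed.

Lemma rf_head k : rf k.+1 (head 0).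
Proof. by apply: rf_ext (rf_var (ltn0Sn k)) => s; rewrite nth0. Qed.

(** Composition with [a] followed by the [k] projections, which restore the old environment behind
    the new entry. *)
Lemma rf_push k f a : rf k.+1 f -> rf k a -> rf k (fun s => f (a s :: s)).
Proof.
move=> rff rfa.
have := @rf_comp k f (a :: [seq nth 0 ^~ i | i <- iota 0 k]).
rewrite /= size_map size_iota => /(_ rff) rfc.
have /rfc rfas : forall i, i < k.+1 ->
    rf k (nth (fun=> 0) (a :: [seq nth 0 ^~ i | i <- iota 0 k]) i).
  case=> // i ik; rewrite /= (nth_map 0) ?size_iota //.
  by apply: rf_var; rewrite nth_iota.
apply: rec_ext rfas _ => v; congr (f (_ :: _)).
by rewrite -map_comp -[RHS](mkseq_nth 0) size_tuple.
Qed.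

Lemma rf_const k n : rf k (fun=> n).
Proof.
have rf0 : rf k (fun=> 0) by apply: (@rf_comp _ (fun=> 0) [::] rec_zero).
elim: n => // n IH; apply: (rf_op1 (op := succn)) (IH).
apply: rec_ext rec_succ _ => v.
by rewrite /thead (tnth_nth 0).
Qed.

Lemma rf_succ k a : rf k a -> rf k (fun s => (a s).+1).
Proof.
apply: (rf_op1 (op := succn)); apply: rec_ext rec_succ _ => v.
by rewrite /thead (tnth_nth 0).
Qed.

(** Primitive recursion written as a fold over [iota 0 n], so that it matches the folds that build
    long conjunctions and disjunctions. *)
Definition loop (n : nat) (h : nat -> nat -> nat) (a : nat) : nat :=
  foldl (fun r i => h i r) a (iota 0 n).

Lemma loopS n h a : loop n.+1 h a = h n (loop n h a).
Proof. by rewrite /loop -addn1 iotaD foldl_cat. Qed.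

Lemma rf_loop k n h a :
  rf k n ->
  rf k.+2 (fun s => h (head 0 s) (head 0 (behead s)) (behead (behead s))) ->
  rf k a -> rf k (fun s => loop (n s) (fun i r => h i r s) (a s)).
Proof.
move=> rfn rfh rfa.
(* Primitive recursion runs on the first argument, so the number of rounds is first an extra head
   entry and is then substituted by [rf_push]. *)
pose f s := loop (head 0 s) (fun i r => h i r (behead s)) (a (behead s)).
suff rff : rf k.+1 f by exact: rf_push rff rfn.
apply: rec_ext (rec_prim rfa rfh) _ => v /=.
rewrite /f /thead (tnth_nth 0) nth0.
by elim: (head 0 v) => // m IH; rewrite loopS -IH.
Qed.

Lemma rf_min k f g :
  rf k.+1 (fun s => g (head 0 s) (behead s)) ->
  (forall s, g (f s) s = 0 /\ forall y, y < f s -> g y s <> 0) -> rf k f.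
Proof. by move=> rfg fP; apply: (rec_min rfg) => v /=; apply: fP. Qed.

Lemma rf_behead2 k f : rf k f -> rf k.+2 (fun s => f (behead (behead s))).
Proof. by move=> rff; apply/(rf_behead (f := fun s => f (behead s)))/rf_behead. Qed.

Ltac rf_base :=
  repeat first [assumption | exact: rf_head | exact: rf_const | exact: rf_var
               | apply: rf_behead2 | apply: rf_behead | apply: rf_succ].

Lemma rf_pred k a : rf k a -> rf k (fun s => (a s).-1).
Proof.
apply: rf_op1.
(* Each round returns its own index, so the last index remains; zero rounds leave 0. *)
apply: (@rf_ext _ (fun s => loop (head 0 s) (fun i r => i) 0)) => [s|].
  by rewrite nth0; case: (head 0 s) => // n; rewrite loopS.
by apply: (rf_loop (h := fun i r s => i)); rf_base.
Qed.

Lemma rf_add k a b : rf k a -> rf k b -> rf k (fun s => a s + b s).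
Proof.
move=> rfa rfb.
apply: (@rf_ext _ (fun s => loop (a s) (fun i r => r.+1) (b s))) => [s|].
  by elim: (a s) => // n IH; rewrite loopS IH.
by apply: (rf_loop (h := fun i r s => r.+1)); rf_base.
Qed.

Lemma rf_mul k a b : rf k a -> rf k b -> rf k (fun s => a s * b s).
Proof.
move=> rfa rfb.
apply: (@rf_ext _ (fun s => loop (a s) (fun i r => b s + r) 0)) => [s|].
  by elim: (a s) => // n IH; rewrite loopS IH mulSn.
apply: (rf_loop (h := fun i r s => b s + r)); rf_base.
by apply: rf_add; rf_base.
Qed.

Lemma rf_sub k a b : rf k a -> rf k b -> rf k (fun s => a s - b s).
Proof.
move=> rfa rfb.
apply: (@rf_ext _ (fun s => loop (b s) (fun i r => r.-1) (a s))) => [s|].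
  by elim: (b s) => [|n IH]; rewrite ?subn0 // loopS IH subnS.
apply: (rf_loop (h := fun i r s => r.-1)); rf_base.
by apply: rf_pred; rf_base.
Qed.

Lemma rf_half k a : rf k a -> rf k (fun s => (a s)./2).
Proof.
move=> rfa.
(* Halves obey the recurrence [n.+1./2 = n - n./2]. *)
apply: (@rf_ext _ (fun s => loop (a s) (fun i r => i - r) 0)) => [s|].
  by elim: (a s) => // n IH; rewrite loopS IH; lia.
apply: (rf_loop (h := fun i r s => i - r)); rf_base.
by apply: rf_sub; rf_base.
Qed.

Lemma rf_odd k a : rf k a -> rf k (fun s => odd (a s)).
Proof.
move=> rfa.
apply: (@rf_ext _ (fun s => a s - ((a s)./2 + (a s)./2))) => [s|]; first lia.
by apply: rf_sub => //; apply: rf_add; apply: rf_half.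
Qed.

Lemma rf_iter k n h a :
  rf k n -> rf 1 (fun s => h (head 0 s)) -> rf k a ->
  rf k (fun s => iter (n s) h (a s)).
Proof.
move=> rfn rfh rfa.
apply: (@rf_ext _ (fun s => loop (n s) (fun i r => h r) (a s))) => [s|].
  by elim: (n s) => //= m IH; rewrite loopS IH.
apply: (rf_loop (h := fun i r s => h r)) => //.
apply: (rf_op1 (op := h)); last by rf_base.
by apply: rf_ext rfh => s; rewrite nth0.
Qed.

(** * Arithmetic of sequence codes *)

Definition hd (m : nat) : nat := head 0 (CodeSeq.decode m).
Definition tl (m : nat) : nat := CodeSeq.code (behead (CodeSeq.decode m)).

(** The code of [n :: s] is a power of two times an odd number. Iterated doubling and halving then
    suffice for building and taking apart lists. *)
Lemma code_cons n s : CodeSeq.code (n :: s) = iter n double (CodeSeq.code s).*2.+1.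
Proof.
transitivity (2 ^ n * (CodeSeq.code s).*2.+1) => //.
elim: n => [|n IH]; first by rewrite mul1n.
by rewrite iterS -IH expnS -mulnA mul2n.
Qed.

Lemma iter_half_double n m : iter n half (iter n double m) = m.
Proof. by elim: n m => // n IH m; rewrite iterSr iterS doubleK IH. Qed.

Lemma iter_double_gt0 n m : 0 < m -> 0 < iter n double m.
Proof. by move=> m_gt0; elim: n => // n IH; rewrite iterS double_gt0. Qed.

Lemma rf_hd k a : rf k a -> rf k (fun s => hd (a s)).
Proof.
apply: rf_op1.
(* The head of [n :: l] is the 2-adic valuation of its code. *)
apply: (@rf_min _ _ (fun y s => (1 - odd (iter y half (head 0 s))) * head 0 s)).
  apply: rf_mul; last by rf_base.
  apply: rf_sub; first exact: rf_const.
  apply: rf_odd; apply: rf_iter; rf_base.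
  by apply: rf_half; rf_base.
move=> s; rewrite nth0; move: (head 0 s) => m.
rewrite -[m]CodeSeq.decodeK /hd CodeSeq.codeK.
(* The empty list has code 0, whose halves are never odd; the factor [m] stops the search at once,
   at the default head 0. *)
case: (CodeSeq.decode m) => [|n l]; first by rewrite muln0.
rewrite code_cons iter_half_double; split=> [|y /= yn]; first by rewrite /= odd_double.
rewrite -(subnK yn) -addSnnS addnC iterD iter_half_double.
have -> : odd (iter (n - y.+1).+1 double (CodeSeq.code l).*2.+1) = false.
  by rewrite /= odd_double.
rewrite mul1n => /eqP; apply/negP; rewrite -lt0n.
by rewrite !iter_double_gt0.
Qed.

Lemma rf_tl k a : rf k a -> rf k (fun s => tl (a s)).
Proof.
move=> rfa.
(* Halving as often as the head says leaves the odd part [(CodeSeq.code l).*2.+1]; one more halving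
   leaves the code of the tail. *)
apply: (@rf_ext _ (fun s => (iter (hd (a s)) half (a s))./2)) => [s|].
  move: (a s) => m; rewrite -[m]CodeSeq.decodeK /hd /tl CodeSeq.codeK.
  case: (CodeSeq.decode m) => // n l.
  by rewrite code_cons iter_half_double /= uphalf_double.
apply: rf_half; apply: rf_iter => //; first exact: rf_hd.
by apply: rf_half; rf_base.
Qed.

Lemma rf_code_nil k : rf k (fun=> CodeSeq.code [::]).
Proof. exact: rf_const. Qed.

Lemma rf_code_cons k a l :
  rf k a -> rf k (fun s => CodeSeq.code (l s)) ->
  rf k (fun s => CodeSeq.code (a s :: l s)).
Proof.
move=> rfa rfl; apply: (@rf_ext _
  (fun s => iter (a s) double (CodeSeq.code (l s) + CodeSeq.code (l s)).+1)) => [s|].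
  by rewrite code_cons addnn.
apply: rf_iter => //; last by apply/rf_succ/rf_add.
apply: (@rf_ext _ (fun s => head 0 s + head 0 s)) => [s|]; first by rewrite addnn.
by apply: rf_add; apply: rf_head.
Qed.

Definition fld (m i : nat) : nat := nth 0 (CodeSeq.decode m) i.

Lemma fldE m i : fld m i = hd (iter i tl m).
Proof.
rewrite -[m]CodeSeq.decodeK /fld /hd CodeSeq.codeK.
elim: i (CodeSeq.decode m) => [|i IH] l; first by rewrite CodeSeq.codeK nth0.
rewrite -nth_behead IH iterSr; congr (head 0 (CodeSeq.decode (iter _ _ _))).
by rewrite /tl CodeSeq.codeK.
Qed.

Lemma rf_fld k a b : rf k a -> rf k b -> rf k (fun s => fld (a s) (b s)).
Proof.
move=> rfa rfb; apply: (@rf_ext _ (fun s => hd (iter (b s) tl (a s)))) => [s|].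
  by rewrite fldE.
by apply: rf_hd; apply: rf_iter => //; apply: rf_tl; apply: rf_head.
Qed.

Lemma rf_size k a : rf k a -> rf k (fun s => size (CodeSeq.decode (a s))).
Proof.
apply: (@rf_op1 _ (fun m => size (CodeSeq.decode m))).
(* Only the empty list has code 0, so the length is the least number of tails that reaches 0. *)
apply: (@rf_min _ _ (fun y s => iter y tl (head 0 s))) => [|s].
  apply: rf_iter; rf_base.
  by apply: rf_tl; rf_base.
rewrite nth0; move: (head 0 s) => m; rewrite -[m]CodeSeq.decodeK CodeSeq.codeK.
move: (CodeSeq.decode m) => l.
have iter_tl i : iter i tl (CodeSeq.code l) = CodeSeq.code (drop i l).
  elim: i => [|i IH]; first by rewrite drop0.
  by rewrite iterS IH /tl CodeSeq.codeK -drop1 drop_drop.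
split=> [|y yl]; rewrite iter_tl; first by rewrite drop_size.
rewrite (drop_nth 0 yl) code_cons => /eqP; apply/negP; rewrite -lt0n.
exact: iter_double_gt0.
Qed.

(** * Computing codes of formulas *)

Definition rform (k : nat) (f : seq nat -> formula) : Prop :=
  rf k (fun s => formula_code (f s)).

Definition ftrue : formula := Equal ord0 ord0.

(** A left fold, so that the code of the result is the accumulator of a [loop]. *)
Definition bigAnd (F : nat -> formula) : seq nat -> formula :=
  foldl (fun r i => And (F i) r) ftrue.
Definition bigOr (F : nat -> formula) : seq nat -> formula :=
  foldl (fun r i => Or (F i) r) (Not ftrue).

Ltac rf_codes :=
  cbn [formula_code]; repeat (apply: rf_code_cons); try exact: rf_code_nil;
  try exact: rf_const; try assumption.

Lemma rform_unary k p u : rf k p -> rform k (fun s => Unary (p s) u).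
Proof. by move=> rfp; rewrite /rform; rf_codes. Qed.
Lemma rform_const k f : rform k (fun=> f).
Proof. exact: rf_const. Qed.
Lemma rform_not k f : rform k f -> rform k (fun s => Not (f s)).
Proof. by move=> rff; rewrite /rform; rf_codes. Qed.
Lemma rform_and k f g :
  rform k f -> rform k g -> rform k (fun s => And (f s) (g s)).
Proof. by move=> rff rfg; rewrite /rform; rf_codes. Qed.
Lemma rform_or k f g :
  rform k f -> rform k g -> rform k (fun s => Or (f s) (g s)).
Proof. by move=> rff rfg; rewrite /rform; rf_codes. Qed.
Lemma rform_forall k u f : rform k f -> rform k (fun s => Forall u (f s)).
Proof. by move=> rff; rewrite /rform; rf_codes. Qed.
Lemma rform_exists k u f : rform k f -> rform k (fun s => Exists u (f s)).
Proof. by move=> rff; rewrite /rform; rf_codes. Qed.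
Lemma rform_count k c n u f :
  rform k f -> rform k (fun s => Count c n u (f s)).
Proof. by move=> rff; rewrite /rform; rf_codes. Qed.

(** The body of a loop sees the index, the accumulator and the environment, whereas the formula
    added in a round depends on the index and the environment alone. Composing with the projections
    that skip position 1 adapts it. *)
Lemma rf_drop_second k g :
  rf k.+1 (fun s => g (head 0 s) (behead s)) ->
  rf k.+2 (fun s => g (head 0 s) (behead (behead s))).
Proof.
move=> rfg; pose hs := nth 0 ^~ 0 :: [seq nth 0 ^~ i.+2 | i <- iota 0 k].
have := @rf_comp k.+2 (fun s => g (head 0 s) (behead s)) hs.
rewrite /= size_map size_iota => /(_ rfg) rfc.
have /rfc rfG : forall i, i < k.+1 -> rf k.+2 (nth (fun=> 0) hs i).
  case=> [|i] ik /=; first exact: rf_var.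
  by rewrite (nth_map 0) ?size_iota //; apply: rf_var; rewrite nth_iota.
apply: rec_ext rfG _ => v; rewrite /= nth0; congr (g _ _).
rewrite -map_comp -[RHS](mkseq_nth 0) !size_behead size_tuple /mkseq.
by apply: eq_map => i /=; rewrite !nth_behead.
Qed.

(** The code of a compound formula depends only on the codes of its two parts, so the fold of
    formulas is mirrored by a loop on numbers. *)
Lemma rform_loop (op : nat) (con : formula -> formula -> formula)
    (base : formula) k F n :
  (forall f g, formula_code (con f g) =
               CodeSeq.code [:: op; formula_code f; formula_code g]) ->
  rform k.+1 (fun s => F (head 0 s) (behead s)) -> rf k n ->
  rform k (fun s => foldl (fun r i => con (F i s) r) base (iota 0 (n s))).
Proof.
move=> conE rfF rfn; apply: (@rf_ext _ (fun s => loop (n s)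
  (fun i r => CodeSeq.code [:: op; formula_code (F i s); r]) (formula_code base))).
  move=> s; rewrite /loop.
  by elim: (iota _ _) base => //= i l IH base; rewrite -IH conE.
apply: (rf_loop (h := fun i r s => CodeSeq.code [:: op; formula_code (F i s); r]))
  => //; last exact: rf_const.
rf_codes; last by rf_base.
exact: (rf_drop_second (g := fun i s => formula_code (F i s))).
Qed.

(** * The sentence of an automaton *)

Lemma rform_bigAnd_iota k F n :
  rform k.+1 (fun s => F (head 0 s) (behead s)) -> rf k n ->
  rform k (fun s => bigAnd (fun i => F i s) (iota 0 (n s))).
Proof. by move=> rfF rfn; apply: (rform_loop (op := 5) (con := And)). Qed.

Lemma rform_bigOr_iota k F n :
  rform k.+1 (fun s => F (head 0 s) (behead s)) -> rf k n ->
  rform k (fun s => bigOr (fun i => F i s) (iota 0 (n s))).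
Proof. by move=> rfF rfn; apply: (rform_loop (op := 6) (con := Or)). Qed.

(** Replaces an index by the list entry stored there; this turns a fold over a coded list into a
    fold over its indices. *)
Lemma rform_fld k F c :
  rform k.+1 (fun s => F (head 0 s) (behead s)) -> rf k c ->
  rform k.+1 (fun s => F (fld (c (behead s)) (head 0 s)) (behead s)).
Proof.
move=> rfF rfc.
apply: (rf_push (f := fun s => formula_code (F (head 0 s) (behead (behead s))))
                (a := fun s => fld (c (behead s)) (head 0 s))).
  exact: (rf_drop_second (g := fun i s => formula_code (F i s))).
by apply: rf_fld; rf_base.
Qed.

Lemma rform_ext k f g : f =1 g -> rform k f -> rform k g.
Proof. by move=> fg; apply: rf_ext => s; rewrite fg. Qed.

Lemma foldl_iota (R : Type) (h : R -> nat -> R) (r : R) (l : seq nat) :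
  foldl h r l = foldl (fun r i => h r (nth 0 l i)) r (iota 0 (size l)).
Proof.
rewrite -[in LHS](mkseq_nth 0 l) /mkseq.
by elim: (iota _ _) r => //= i s IH r; rewrite IH.
Qed.

Lemma rform_bigAnd_decode k F c :
  rform k.+1 (fun s => F (head 0 s) (behead s)) -> rf k c ->
  rform k (fun s => bigAnd (fun i => F i s) (CodeSeq.decode (c s))).
Proof.
move=> rfF rfc; apply: (@rform_ext _ (fun s => bigAnd
  (fun i => F (fld (c s) i) s) (iota 0 (size (CodeSeq.decode (c s)))))) => [s|].
  by rewrite /bigAnd [in RHS]foldl_iota.
apply: (rform_bigAnd_iota (F := fun i s => F (fld (c s) i) s)).
  exact: (rform_fld (F := F) (c := c)).
exact: rf_size.
Qed.

Lemma rform_bigOr_decode k F c :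
  rform k.+1 (fun s => F (head 0 s) (behead s)) -> rf k c ->
  rform k (fun s => bigOr (fun i => F i s) (CodeSeq.decode (c s))).
Proof.
move=> rfF rfc; apply: (@rform_ext _ (fun s => bigOr
  (fun i => F (fld (c s) i) s) (iota 0 (size (CodeSeq.decode (c s)))))) => [s|].
  by rewrite /bigOr [in RHS]foldl_iota.
apply: (rform_bigOr_iota (F := fun i s => F (fld (c s) i) s)).
  exact: (rform_fld (F := F) (c := c)).
exact: rf_size.
Qed.

(** The base [ftrue] mentions the first variable, so the hypothesis on [ftrue] makes [w] the second
    one. *)
Lemma free_bigAnd w F l :
  (forall i, free w (F i) = false) -> free w ftrue = false ->
  free w (bigAnd F l) = false.
Proof.
move=> freeF; rewrite /bigAnd; elim: l ftrue => //= i l IH f freef.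
by apply: IH; rewrite /= freeF.
Qed.

Lemma free_bigOr w F l :
  (forall i, free w (F i) = false) -> free w ftrue = false ->
  free w (bigOr F l) = false.
Proof.
move=> freeF; rewrite /bigOr.
have -> : free w ftrue = free w (Not ftrue) by [].
elim: l (Not ftrue) => //= i l IH f freef.
by apply: IH; rewrite /= freeF.
Qed.

Lemma holds_bigAnd (M : structure) F l (e : 'I_2 -> dom M) :
  holds (bigAnd F l) e = all (fun i => holds (F i) e) l.
Proof.
have : holds ftrue e by exact: eqxx.
rewrite /bigAnd -[RHS]andTb => <-; elim: l ftrue => [|i l IH] f /=.
  by rewrite andbT.
by rewrite IH /= andbCA andbA.
Qed.

Lemma holds_bigOr (M : structure) F l (e : 'I_2 -> dom M) :
  holds (bigOr F l) e = has (fun i => holds (F i) e) l.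
Proof.
have hF : holds (Not ftrue) e = false by rewrite /= eqxx.
rewrite /bigOr -[RHS]orFb -[in RHS]hF; elim: l (Not ftrue) => [|i l IH] f /=.
  by rewrite orbF.
by rewrite IH /= orbCA orbA.
Qed.

Definition vx : 'I_2 := Ordinal (isT : 0 < 2).
Definition vy : 'I_2 := Ordinal (isT : 1 < 2).

(** The values of [op_code] on plain numbers, since the sentence is built from an arbitrary number
    rather than from an automaton. *)
Definition inc_code (c : nat) : nat := CodeSeq.code [:: 0; c].
Definition dec_code (c : nat) : nat := CodeSeq.code [:: 1; c].
Definition skip_code : nat := CodeSeq.code [:: 2].

(* Even predicate numbers name states, odd ones name operations. *)
Definition in_state (q : nat) (u : 'I_2) : formula := Unary (q + q) u.
Definition does (o : nat) (u : 'I_2) : formula := Unary (o + o).+1 u.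

(* Downward edges encode the successor relation, upward edges the matching. *)
Definition succ_edge (u v : 'I_2) : formula := And (Less u v) (Binary v u).
Definition match_edge (u v : 'I_2) : formula := And (Less u v) (Binary u v).

(* Exceeds all states, counters and operation codes of the automaton. *)
Definition bound (m : nat) : nat := fld m 0 + CodeSeq.code [:: 2; fld m 1].

(** A minimal element has no downward edge and is thereby forced into the second disjunct, hence
    into the initial state. *)
Definition phi_first (m : nat) : formula :=
  Forall vx (Or (Exists vy (succ_edge vy vx))
                (And (Not (Exists vy (Less vy vx))) (in_state (fld m 4) vx))).

Definition phi_succ : formula := Forall vx (Count CLe 1 vy (succ_edge vx vy)).

(** No transition leaves the maximal element. Making it skip prevents it from posing as the
    decrement that matches some increment. *)
Definition phi_last (m : nat) : formula :=
  Forall vx (Or (Exists vy (Less vx vy))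
                (And (does skip_code vx)
                     (bigOr (fun q => in_state q vx) (CodeSeq.decode (fld m 5))))).

Definition phi_trans (m : nat) : formula :=
  Forall vx (Forall vy (Or (Not (succ_edge vx vy))
    (bigOr (fun t => And (in_state (fld t 0) vx)
                         (And (does (fld t 1) vx) (in_state (fld t 2) vy)))
           (CodeSeq.decode (fld m 3))))).

Definition phi_excl (m : nat) : formula :=
  Forall vx (bigAnd (fun i => bigAnd (fun j =>
      And (Not (And (in_state i vx) (in_state j vx)))
          (Not (And (does i vx) (does j vx))))
    (iota 0 i)) (iota 0 (bound m))).

(** Uniqueness at increments makes the map from decrements to increments injective, so counters stay
    nonnegative. Uniqueness at decrements does the same for the converse map, which exists on tested
    counters by [phi_zero]. *)
Definition phi_match (m : nat) : formula :=
  Forall vx (bigAnd (fun c =>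
      And (Or (Not (does (dec_code c) vx))
              (And (Exists vy (And (match_edge vy vx) (does (inc_code c) vy)))
                   (Count CLe 1 vy (And (match_edge vy vx) (does (inc_code c) vy)))))
          (Or (Not (does (inc_code c) vx))
              (Count CLe 1 vy (And (match_edge vx vy) (does (dec_code c) vy)))))
    (iota 0 (bound m))).

Definition phi_zero (m : nat) : formula :=
  Forall vx (bigAnd (fun c =>
      Or (Not (does (inc_code c) vx))
         (Exists vy (And (match_edge vx vy) (does (dec_code c) vy))))
    (CodeSeq.decode (fld m 2))).

Definition phi (m : nat) : formula :=
  And (And (And (phi_first m) phi_succ) (And (phi_last m) (phi_trans m)))
      (And (phi_excl m) (And (phi_match m) (phi_zero m))).

Lemma phi_closed m : Defs.closed (phi m).
Proof.
apply/forallP=> w.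
have [->|->] : w = vx \/ w = vy.
  by case: w => [[|[|//]] lt_w]; [left | right]; apply: val_inj.
(* Every clause starts with [Forall vx], so computation settles x; for y the folds over unknown
   lists need the lemmas above. *)
- by [].
- have freeF F l : (forall i, free vy (F i) = false) -> free vy (bigOr F l) = false.
    by move=> freeF; apply: free_bigOr.
  have freeA F l : (forall i, free vy (F i) = false) -> free vy (bigAnd F l) = false.
    by move=> freeA; apply: free_bigAnd.
  rewrite /phi /phi_first /phi_succ /phi_last /phi_trans /phi_excl /phi_match
    /phi_zero; cbn [free]; rewrite eqxx !andFb !freeF ?freeA //= => i.
  by rewrite freeA.
Qed.

(** * Computability of the sentence *)

Lemma rform_state k p u : rf k p -> rform k (fun s => in_state (p s) u).
Proof. by move=> rfp; apply: (rform_unary (p := fun s => p s + p s)); apply: rf_add. Qed.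

Lemma rform_does k p u : rf k p -> rform k (fun s => does (p s) u).
Proof.
move=> rfp; apply: (rform_unary (p := fun s => (p s + p s).+1)).
by apply: rf_succ; apply: rf_add.
Qed.

Lemma rf_inc : rf 1 (fun s => inc_code (nth 0 s 0)).
Proof.
apply: rf_code_cons; first exact: rf_const.
by apply: rf_code_cons; [apply: rf_var | apply: rf_code_nil].
Qed.

Lemma rf_dec : rf 1 (fun s => dec_code (nth 0 s 0)).
Proof.
apply: rf_code_cons; first exact: rf_const.
by apply: rf_code_cons; [apply: rf_var | apply: rf_code_nil].
Qed.

Lemma rf_bound : rf 1 (fun s => bound (nth 0 s 0)).
Proof.
apply: rf_add; first by apply: rf_fld; [apply: rf_var | apply: rf_const].
apply: rf_code_cons; first exact: rf_const.
apply: rf_code_cons; last exact: rf_code_nil.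
by apply: rf_fld; [apply: rf_var | apply: rf_const].
Qed.

Ltac rform_step :=
  lazymatch goal with
  | |- rform _ (fun _ => ?f) => apply: rform_const
  | |- rform _ (fun s => And (@?f s) (@?g s)) => apply: (rform_and (f := f) (g := g))
  | |- rform _ (fun s => Or (@?f s) (@?g s)) => apply: (rform_or (f := f) (g := g))
  | |- rform _ (fun s => Not (@?f s)) => apply: (rform_not (f := f))
  | |- rform _ (fun s => Forall ?u (@?f s)) => apply: (rform_forall u (f := f))
  | |- rform _ (fun s => Exists ?u (@?f s)) => apply: (rform_exists u (f := f))
  | |- rform _ (fun s => Count ?c ?n ?u (@?f s)) => apply: (rform_count c n u (f := f))
  | |- rform _ (fun s => in_state (@?p s) ?u) => apply: (rform_state u (p := p))
  | |- rform _ (fun s => does (@?p s) ?u) => apply: (rform_does u (p := p))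
  | |- rf _ (fun s => fld (@?a s) _) => apply: (rf_fld (a := a)); last apply: rf_const
  | |- rf _ (fun s => inc_code (@?a s)) =>
      apply: (rf_op1 (op := inc_code) (a := a)); first exact: rf_inc
  | |- rf _ (fun s => dec_code (@?a s)) =>
      apply: (rf_op1 (op := dec_code) (a := a)); first exact: rf_dec
  | |- rf _ (fun s => bound (@?a s)) =>
      apply: (rf_op1 (op := bound) (a := a)); first exact: rf_bound
  | |- rf _ (fun _ => ?n) => apply: rf_const
  | rfa : rf ?k ?a |- rf ?k (fun s => ?a s) => exact: rfa
  | |- rf _ _ => by rf_base
  end.

Lemma rform_phi k a : rf k a -> rform k (fun s => phi (a s)).
Proof.
move=> rfa; rewrite /phi /phi_first /phi_last /phi_trans /phi_excl
  /phi_match /phi_zero.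
repeat rform_step.
- apply: (rform_bigOr_decode (c := fun s => fld (a s) 5)
    (F := fun q s => in_state q vx)); by repeat rform_step.
- apply: (rform_bigOr_decode (c := fun s => fld (a s) 3)
    (F := fun t s => And (in_state (fld t 0) vx)
     (And (does (fld t 1) vx) (in_state (fld t 2) vy)))); by repeat rform_step.
- apply: (rform_bigAnd_iota (n := fun s => bound (a s))
    (F := fun i s => bigAnd (fun j =>
    And (Not (And (in_state i vx) (in_state j vx)))
        (Not (And (does i vx) (does j vx)))) (iota 0 i))); last by repeat rform_step.
  apply: (rform_bigAnd_iota (n := head 0) (F := fun j s =>
    And (Not (And (in_state (head 0 s) vx) (in_state j vx)))
        (Not (And (does (head 0 s) vx) (does j vx))))); by repeat rform_step.
- apply: (rform_bigAnd_iota (n := fun s => bound (a s))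
    (F := fun c s => And
      (Or (Not (does (dec_code c) vx))
              (And (Exists vy (And (match_edge vy vx) (does (inc_code c) vy)))
                   (Count CLe 1 vy (And (match_edge vy vx) (does (inc_code c) vy)))))
          (Or (Not (does (inc_code c) vx))
              (Count CLe 1 vy (And (match_edge vx vy) (does (dec_code c) vy))))));
    by repeat rform_step.
- apply: (rform_bigAnd_decode (c := fun s => fld (a s) 2)
    (F := fun c s => Or (Not (does (inc_code c) vx))
         (Exists vy (And (match_edge vx vy) (does (dec_code c) vy)))));
    by repeat rform_step.
Qed.

(** * Runs and occurrences of operations *)

Section Occurrences.
Variables (T : eqType) (w : nat -> T).

Definition occ (o : T) (i : nat) : nat := count (fun j => w j == o) (iota 0 i).

Lemma occS o i : occ o i.+1 = occ o i + (w i == o).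
Proof. by rewrite /occ -addn1 iotaD count_cat /= addn0. Qed.

Lemma occ_le o i j : i <= j -> occ o i <= occ o j.
Proof. by move=> ij; rewrite /occ -(subnK ij) addnC iotaD count_cat leq_addr. Qed.

Lemma occ_lt o i j : w i = o -> i < j -> occ o i < occ o j.
Proof. by move=> wi /(occ_le o); rewrite occS wi eqxx addn1. Qed.

Lemma occ_pos_inj o i j : w i = o -> w j = o -> occ o i = occ o j -> i = j.
Proof.
by move=> wi wj eij; case: (ltngtP i j) => // /occ_lt ltij;
  [have := ltij _ wi | have := ltij _ wj]; rewrite eij ltnn.
Qed.

(** The count grows by at most one per position, so it passes from [k] to [k.+1] at an occurrence of
    [o]: the one of rank [k], counted from zero. *)
Lemma occ_reach o k i : k < occ o i -> exists2 j, j < i & w j = o /\ occ o j = k.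
Proof.
elim: i => // i IH; rewrite occS.
case: (ltnP k (occ o i)) => [/IH [j ji wj] _ | ik]; first by exists j => //; lia.
by case: eqP => wi /= ki; exists i => //; split=> //; lia.
Qed.

(** Pigeonhole: sending each occurrence of [o] to its first [r]-partner is an injection into the
    occurrences of [o']. *)
Lemma occ_leq_inj o o' a b (r : rel nat) :
  (forall j, j < a -> w j = o -> exists2 k, k < b & w k = o' /\ r j k) ->
  (forall j j' k, j < a -> j' < a -> w j = o -> w j' = o ->
     k < b -> w k = o' -> r j k -> r j' k -> j = j') ->
  occ o a <= occ o' b.
Proof.
move=> r_total r_inj; rewrite /occ -!size_filter.
pose f j := head 0 [seq k <- iota 0 b | (w k == o') && r j k].
have fP j : j \in [seq j <- iota 0 a | w j == o] ->
    [/\ j < a, w j = o, f j < b, w (f j) = o' & r j (f j)].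
  rewrite mem_filter mem_iota add0n => /andP[/eqP wj /= ja].
  have [k kb [wk rk]] := r_total j ja wj.
  have : f j \in [seq k <- iota 0 b | (w k == o') && r j k].
    have : k \in [seq k <- iota 0 b | (w k == o') && r j k].
      by rewrite mem_filter wk eqxx rk mem_iota.
    by rewrite /f; case: [seq _ <- _ | _] => //= *; rewrite mem_head.
  by rewrite mem_filter mem_iota add0n => /andP[/andP[/eqP ? ?] /= ?].
rewrite -(size_map f); apply: uniq_leq_size.
  rewrite map_inj_in_uniq ?filter_uniq ?iota_uniq //.
  move=> i j /fP[? ? ? ? ri] /fP[? ? ? ? rj] eij.
  by apply: (r_inj i j (f i)); rewrite // eij.
by move=> k /mapP[j /fP[? ? ? wf ?] ->]; rewrite mem_filter wf eqxx mem_iota.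
Qed.

End Occurrences.

(** One additive equation covers all three operations without truncated subtraction and fits the
    recurrence [occS]. *)
Lemma op_stepP (C : finType) (o : op C) (n n' : {ffun C -> nat}) :
  reflect ((forall c, n' c + (o == Dec c) = n c + (o == Inc c)) /\
           (forall c, o = Dec c -> 0 < n c))
          (op_step o n n').
Proof.
have IncE (c d : C) : (Inc c == Inc d) = (d == c).
  by rewrite eq_sym; apply/eqP/eqP => [[]|->].
have DecE (c d : C) : (Dec c == Dec d) = (d == c).
  by rewrite eq_sym; apply/eqP/eqP => [[]|->].
have IDE (c d : C) : (Inc c == Dec d) = false by apply/eqP.
have DIE (c d : C) : (Dec c == Inc d) = false by apply/eqP.
have SIE (d : C) : (Skip == Inc d) = false by apply/eqP.
have SDE (d : C) : (Skip == Dec d) = false by apply/eqP.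
apply: (iffP idP); case: o => [c|c|]; rewrite /op_step.
- move/eqP=> ->; split=> // d; rewrite ffunE IncE IDE.
  by case: eqP; rewrite ?addn0 ?addn1.
- case/andP=> n0 /eqP ->; split=> [d|d [<-] //]; rewrite ffunE DecE DIE.
  by case: eqP => [->|_]; rewrite ?addn0 ?addn1 ?prednK.
- by move/eqP=> ->; split=> // d; rewrite SIE SDE.
- case=> nn _; apply/eqP/ffunP=> d; have := nn d; rewrite ffunE IncE IDE.
  by case: eqP; rewrite ?addn0 ?addn1.
- case=> nn n0; rewrite (n0 c) //=; apply/eqP/ffunP=> d; have := nn d.
  by rewrite ffunE DecE DIE; case: eqP => _; rewrite ?addn0 ?addn1 // => <-.
- case=> nn _; apply/eqP/ffunP=> d; have := nn d.
  by rewrite SIE SDE !addn0.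
Qed.

(** A run without its counter vectors: the value of [c] before step [i] is recovered as
    [occ w (Inc c) i - occ w (Dec c) i]. *)
Definition valid_trace (Q C : finType) (A : mca Q C) (n : nat)
    (st : nat -> Q) (w : nat -> op C) : Prop :=
  [/\ st 0 = init A,
      forall i, i < n -> (st i, w i, st i.+1) \in delta A,
      st n \in final A,
      forall i c, i < n -> w i = Dec c -> occ w (Dec c) i < occ w (Inc c) i &
      forall c, c \in zero_tested A -> occ w (Inc c) n = occ w (Dec c) n].

Lemma accepting_run_trace (Q C : finType) (A : mca Q C) :
  has_accepting_run A -> exists n st w, @valid_trace Q C A n st w.
Proof.
case=> s [/(pathP (init_config A)) steps acc].
pose cf i := nth (init_config A) (init_config A :: s) i.
pose w i := odflt Skip [pick o | (((cf i).1, o, (cf i.+1).1) \in delta A) &&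
  op_step o (cf i).2 (cf i.+1).2].
have wP i : i < size s -> ((cf i).1, w i, (cf i.+1).1) \in delta A /\
    op_step (w i) (cf i).2 (cf i.+1).2.
  move=> /steps /existsP[o oP]; rewrite /w; case: pickP => [o' /andP[] // | /(_ o)].
  by rewrite oP.
have cnt i c : i <= size s -> (cf i).2 c + occ w (Dec c) i = occ w (Inc c) i.
  elim: i => [_|i IH lti]; first by rewrite ffunE.
  have [_ /op_stepP[/(_ c) e _]] := wP i lti.
  by have := IH (ltnW lti); rewrite !occS; lia.
have last_cf : last (init_config A) s = cf (size s).
  by rewrite /cf (last_nth (init_config A)).
move: acc; rewrite last_cf => /andP[fin /forall_inP zero].
exists (size s), (fun i => (cf i).1), w; split=> //.
- by move=> i /wP[].
- move=> i c lti wi; have [_ /op_stepP[_ /(_ c wi)]] := wP i lti.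
  by move=> n_gt0; rewrite -(cnt i c (ltnW lti)) -[X in X < _]add0n ltn_add2r.
- by move=> c /zero /eqP z; rewrite -cnt // z.
Qed.

Lemma trace_accepting_run (Q C : finType) (A : mca Q C) n st w :
  @valid_trace Q C A n st w -> has_accepting_run A.
Proof.
case=> st0 tr fin decs zero.
pose cf i : config Q C := (st i, [ffun c => occ w (Inc c) i - occ w (Dec c) i]).
have cf0 : cf 0 = init_config A.
  by rewrite /cf /init_config st0; congr (_, _); apply/ffunP=> c; rewrite !ffunE.
(* Hence the truncated differences in [cf] are true differences. *)
have le i c : i <= n -> occ w (Dec c) i <= occ w (Inc c) i.
  elim: i => // i IH lti; have := IH (ltnW lti); rewrite !occS.
  by case: eqP => [/(decs i c lti)|_]; lia.
have cfE i : i <= n -> nth (cf 0) (cf 0 :: mkseq (cf \o S) n) i = cf i.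
  by case: i => // i lti /=; rewrite nth_mkseq.
exists (mkseq (cf \o S) n); rewrite -cf0; split.
  apply/(pathP (cf 0)) => i; rewrite size_mkseq => lti.
  rewrite cfE 1?ltnW // nth_mkseq //; apply/existsP; exists (w i).
  rewrite /= tr //=; apply/op_stepP; split=> c; rewrite !ffunE.
    have := le i.+1 c lti; have := le i c (ltnW lti); rewrite !occS.
    have : ~~ ((w i == Inc c) && (w i == Dec c)) by apply/andP=> -[/eqP -> /eqP].
    by case: eqP; case: eqP => //=; lia.
  by move=> /(decs i c lti); rewrite subn_gt0.
rewrite (last_nth (cf 0)) size_mkseq cfE // /accepting fin.
by apply/forall_inP=> c /zero e; rewrite ffunE e subnn.
Qed.

(** * Models of the sentence *)

(* Otherwise unification evaluates these powers of two in unary. *)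
Opaque inc_code dec_code skip_code.

(** The clauses of [phi m] read in the model, with each bound [CLe 1] turned into a uniqueness
    statement. *)
Record encodes (m : nat) (M : structure) : Prop := Encodes {
  enc_first (x : dom M) :
    (exists2 y, (y < x)%O & binary x y) \/
    (~ (exists y, (y < x)%O) /\ unary (fld m 4 + fld m 4) x);
  enc_succ (x y z : dom M) :
    (x < y)%O -> binary y x -> (x < z)%O -> binary z x -> y = z;
  enc_last (x : dom M) :
    (exists y, (x < y)%O) \/
    (unary (skip_code + skip_code).+1 x /\
     exists2 q, q \in CodeSeq.decode (fld m 5) & unary (q + q) x);
  enc_trans (x y : dom M) :
    (x < y)%O -> binary y x ->
    exists2 t, t \in CodeSeq.decode (fld m 3) &
      [/\ unary (fld t 0 + fld t 0) x, unary (fld t 1 + fld t 1).+1 x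
        & unary (fld t 2 + fld t 2) y];
  enc_excl (x : dom M) i j :
    j < i -> i < bound m ->
    ~ (unary (i + i) x /\ unary (j + j) x) /\
    ~ (unary (i + i).+1 x /\ unary (j + j).+1 x);
  enc_dec (x : dom M) c :
    c < bound m -> unary (dec_code c + dec_code c).+1 x ->
    (exists y, [/\ (y < x)%O, binary y x & unary (inc_code c + inc_code c).+1 y]) /\
    (forall y z,
      [/\ (y < x)%O, binary y x & unary (inc_code c + inc_code c).+1 y] ->
      [/\ (z < x)%O, binary z x & unary (inc_code c + inc_code c).+1 z] -> y = z);
  enc_inc (x : dom M) c :
    c < bound m -> unary (inc_code c + inc_code c).+1 x ->
    forall y z,
      [/\ (x < y)%O, binary x y & unary (dec_code c + dec_code c).+1 y] ->
      [/\ (x < z)%O, binary x z & unary (dec_code c + dec_code c).+1 z] -> y = z;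
  enc_zero (x : dom M) c :
    c \in CodeSeq.decode (fld m 2) -> unary (inc_code c + inc_code c).+1 x ->
    exists y, [/\ (x < y)%O, binary x y & unary (dec_code c + dec_code c).+1 y]
}.

Lemma phi_encodes m (M : structure) :
  (forall e : 'I_2 -> dom M, holds (phi m) e) <-> encodes m M.
Proof.
(* Evaluating the sentence takes some assignment, which a nonempty domain provides. *)
have [d _] : exists d : dom M, true.
  by move: (dom_nonempty M); case/card_gt0P=> d; exists d.
have cardP (P : pred (dom M)) : reflect (forall y z, P y -> P z -> y = z) (#|P| <= 1).
  by apply: (iffP card_le1_eqP) => h y z Py Pz; apply: h.
split=> [/(_ (fun=> d))|[hfirst hsucc hlast htrans hexcl hdec hinc hzero] e].
  rewrite /phi /phi_first /phi_succ /phi_last /phi_trans /phi_excl /phi_match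
    /phi_zero; cbn [holds]; rewrite -!andbA.
  case/and5P=> hfirst hsucc hlast htrans /and3P[hexcl hmatch hzero].
  split.
  - move=> x; move/forallP/(_ x): hfirst.
    case/orP=> [/existsP[y /andP[]]|/andP[/existsPn no_y first]]; first by left; exists y.
    by right; split=> // -[y yx]; have := no_y y; rewrite /= yx.
  - move=> x y z xy Eyx xz Ezx; move/forallP/(_ x)/cardP: hsucc.
    by apply; rewrite /in_mem /= ?xy ?xz.
  - move=> x; move/forallP/(_ x): hlast.
    case/orP=> [/existsP[y xy]|/andP[skip]]; first by left; exists y.
    by rewrite holds_bigOr => /hasP[q qF Sq]; right; split=> //; exists q.
  - move=> x y xy Eyx; move/forallP/(_ x)/forallP/(_ y): htrans.
    case/orP=> [/negP[]|]; first exact/andP.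
    rewrite holds_bigOr => /hasP[t tD /andP[Sp /andP[Oo Sq]]].
    by exists t.
  - move=> x i j ji iN; move/forallP/(_ x): hexcl.
    rewrite holds_bigAnd => /allP/(_ i); rewrite mem_iota => /(_ iN).
    rewrite holds_bigAnd => /allP/(_ j); rewrite mem_iota => /(_ ji).
    by case/andP=> /negP hS /negP hO; split=> [/andP|/andP].
  - move=> x c cN Dc; move/forallP/(_ x): hmatch.
    rewrite holds_bigAnd => /allP/(_ c); rewrite mem_iota => /(_ cN).
    case/andP=> /orP[/negP//|/andP[/existsP[y /andP[/andP[yx Eyx] Iy]] /cardP uniq]] _.
    split; first by exists y.
    by move=> y' z [? ? ?] [? ? ?]; apply: uniq; apply/andP; split=> //; apply/andP.
  - move=> x c cN Ic y z [? ? ?] [? ? ?]; move/forallP/(_ x): hmatch.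
    rewrite holds_bigAnd => /allP/(_ c); rewrite mem_iota => /(_ cN).
    by case/andP=> _ /orP[/negP//|/cardP]; apply; apply/andP; split=> //; apply/andP.
  - move=> x c cR Ic; move/forallP/(_ x): hzero.
    rewrite holds_bigAnd => /allP/(_ c cR).
    by case/orP=> [/negP//|/existsP[y /andP[/andP[xy Exy] Dy]]]; exists y.
rewrite /phi /phi_first /phi_succ /phi_last /phi_trans /phi_excl /phi_match
    /phi_zero; cbn [holds]; rewrite -!andbA.
apply/and5P; split; last (apply/and3P; split); apply/forallP => x.
- case: (hfirst x) => [[y yx Exy]|[no_y first]]; apply/orP.
    by left; apply/existsP; exists y; apply/andP.
  right; apply/andP; split=> //; apply/existsPn=> y; apply/negP=> yx.
  by apply: no_y; exists y.
- by apply/cardP=> y z /andP[xy Ey] /andP[xz Ez]; apply: (hsucc x).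
- case: (hlast x) => [[y xy]|[skip [q qF Sq]]]; apply/orP.
    by left; apply/existsP; exists y.
  by right; apply/andP; split=> //; rewrite holds_bigOr; apply/hasP; exists q.
- apply/forallP=> y; apply/orP; case: (boolP ((x < y)%O && binary y x));
    last by left.
  move=> /andP[xy Eyx].
  right; rewrite holds_bigOr; apply/hasP.
  have [t tD [Sp Oo Sq]] := htrans x y xy Eyx; exists t => //.
  by apply/andP; split=> //; apply/andP.
- rewrite holds_bigAnd; apply/allP=> i; rewrite mem_iota => iN.
  rewrite holds_bigAnd; apply/allP=> j; rewrite mem_iota => ji.
  by have [hS hO] := hexcl x i j ji iN; apply/andP; split; apply/negP=> /andP.
- rewrite holds_bigAnd; apply/allP=> c; rewrite mem_iota => cN.
  apply/andP; split; apply/orP.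
    case: (boolP (unary (dec_code c + dec_code c).+1 x)) => [Dc|no]; last by left.
    have [[y [yx Ey Iy]] uniq] := hdec x c cN Dc.
    right; apply/andP; split.
      by apply/existsP; exists y; apply/andP; split=> //; apply/andP.
    by apply/cardP=> y' z /andP[/andP[? ?] ?] /andP[/andP[? ?] ?]; apply: uniq.
  case: (boolP (unary (inc_code c + inc_code c).+1 x)) => [Ic|no]; last by left.
  right; apply/cardP=> y' z /andP[/andP[? ?] ?] /andP[/andP[? ?] ?].
  exact: (hinc x c cN Ic).
- rewrite holds_bigAnd; apply/allP=> c cR; apply/orP.
  case: (boolP (unary (inc_code c + inc_code c).+1 x)) => [Ic|no]; last by left.
  have [y [xy Exy Dy]] := hzero x c cR Ic; right; apply/existsP; exists y.
  by apply/andP; split=> //; apply/andP.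
Qed.

(** * Operation codes and the fields of an automaton's code *)

Lemma op_codeE m (o : op 'I_m) :
  op_code o = match o with
              | Inc c => inc_code c | Dec c => dec_code c | Skip => skip_code
              end.
Proof. by case: o. Qed.

(** The sentence speaks of all [c] below the bound; a code carried by an actual operation shows that
    [c] is a genuine counter. *)
Lemma inc_code_inj m (o : op 'I_m) (c : nat) :
  op_code o = inc_code c -> exists2 d : 'I_m, o = Inc d & c = d.
Proof. by case: o => [d|d|] /code_inj // [<-]; exists d. Qed.

Lemma dec_code_inj m (o : op 'I_m) (c : nat) :
  op_code o = dec_code c -> exists2 d : 'I_m, o = Dec d & c = d.
Proof. by case: o => [d|d|] /code_inj // [<-]; exists d. Qed.

Section Fields.
Variable A : mca_input.
Let m := mca_code A.

Lemma decode_mca_code :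
  CodeSeq.decode m = [:: nstates A; ncounters A;
        CodeSeq.code [seq val c | c <- enum (zero_tested (automaton A))];
        CodeSeq.code [seq trans_code t | t <- enum (delta (automaton A))];
        val (init (automaton A));
        CodeSeq.code [seq val q | q <- enum (final (automaton A))]].
Proof. exact: CodeSeq.codeK. Qed.

Lemma fld_init : fld m 4 = init (automaton A).
Proof. by rewrite /fld decode_mca_code. Qed.

Lemma fld_zero_tested :
  CodeSeq.decode (fld m 2) = [seq val c | c <- enum (zero_tested (automaton A))].
Proof. by rewrite /fld decode_mca_code CodeSeq.codeK. Qed.

Lemma fld_delta :
  CodeSeq.decode (fld m 3) = [seq trans_code t | t <- enum (delta (automaton A))].
Proof. by rewrite /fld decode_mca_code CodeSeq.codeK. Qed.

Lemma fld_final :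
  CodeSeq.decode (fld m 5) = [seq val q | q <- enum (final (automaton A))].
Proof. by rewrite /fld decode_mca_code CodeSeq.codeK. Qed.

Lemma fld_trans_code n k (t : 'I_n * op 'I_k * 'I_n) :
  [/\ fld (trans_code t) 0 = t.1.1, fld (trans_code t) 1 = op_code t.1.2
    & fld (trans_code t) 2 = t.2].
Proof. by rewrite /fld /trans_code CodeSeq.codeK. Qed.

Lemma state_bound (q : 'I_(nstates A)) : q < bound m.
Proof.
rewrite /bound {1}/fld decode_mca_code /=; apply: leq_trans (ltn_ord q) _.
exact: leq_addr.
Qed.

Lemma op_code_bound (o : op 'I_(ncounters A)) : op_code o < bound m.
Proof.
(* The last summand is 8 * 2 ^ [ncounters A] + 4, whereas the operations have codes 2 * 2 ^ c + 1, 4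
   * 2 ^ c + 2 and 4. *)
have -> : bound m = nstates A + CodeSeq.code [:: 2; ncounters A].
  by rewrite /bound /fld decode_mca_code.
case: o => [c|c|] /=; rewrite ?expn_gt0;
  try have: 2 ^ c < 2 ^ ncounters A by rewrite ltn_exp2l.
all: have := expn_gt0 2 (ncounters A); lia.
Qed.

Lemma inc_bound (c : 'I_(ncounters A)) : c < bound m.
Proof.
apply: leq_trans (op_code_bound (Inc c)); rewrite ltnS.
by apply: ltnW; move: (CodeSeq.ltn_code [:: 0; val c]) => /and3P[].
Qed.

End Fields.

(** * From a run to a model *)

Section Model.
Variables (A : mca_input) (n : nat) (st : nat -> 'I_(nstates A)).
Variable w : nat -> op 'I_(ncounters A).
Hypothesis valid : valid_trace (automaton A) n st w.

(** The values of [w] from [n] on are arbitrary, but the maximal element [n] has to skip. *)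
Let w' (i : nat) : op 'I_(ncounters A) := if i < n then w i else Skip.

Definition trace_unary (p : nat) (i : 'I_n.+1) : bool :=
  if odd p then op_code (w' i) == p./2 else val (st i) == p./2.

(* The second case is the first-in first-out matching. *)
Definition trace_binary (x y : 'I_n.+1) : bool :=
  if y < x then y.+1 == x
  else [exists c, [&& w' x == Inc c, w' y == Dec c &
                      occ w (Inc c) x == occ w (Dec c) y]].

Definition trace_model : structure :=
  @Structure _ 'I_n.+1 (eq_ind_r (leq 1) (ltn0Sn n) (card_ord n.+1))
    trace_unary trace_binary.

Lemma trace_state q i : trace_unary (q + q) i = (val (st i) == q).
Proof. by rewrite /trace_unary addnn odd_double doubleK. Qed.

Lemma trace_op o i : trace_unary (o + o).+1 i = (op_code (w' i) == o).
Proof. by rewrite /trace_unary addnn /= odd_double uphalf_double. Qed.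

Lemma trace_model_encodes : encodes (mca_code A) trace_model.
Proof.
case: valid => st0 tr fin decs zero.
have w'E (i : 'I_n.+1) c : w' i = Inc c \/ w' i = Dec c -> i < n /\ w i = w' i.
  by rewrite /w'; case: ltnP => // _ [].
have dec_inc (x : 'I_n.+1) c : w' x = Dec c -> occ w (Dec c) x < occ w (Inc c) x.
  by move=> wx; have [xn wE] := w'E x c (or_intror wx); apply: decs; rewrite ?wE.
split=> /=.
- move=> x; case: (posnP x) => [x0|x_gt0].
    right; rewrite trace_state fld_init x0 st0 eqxx; split=> // -[y].
    by rewrite ltEord x0.
  have y_lt : x.-1 < n.+1 by rewrite (leq_ltn_trans (leq_pred _)).
  by left; exists (Ordinal y_lt); rewrite ?ltEord /trace_binary /= prednK // leqnn.
- move=> x y z; rewrite !ltEord /trace_binary => xy + xz; rewrite xy xz.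
  by move=> /eqP xy' /eqP xz'; apply: val_inj; rewrite /= -xy' -xz'.
- move=> x; case: (ltnP x n) => [xn|nx]; first by left; exists ord_max; rewrite ltEord.
  have xE : val x = n by apply/eqP; rewrite eqn_leq nx -ltnS ltn_ord.
  right; rewrite trace_op /w' xE ltnn op_codeE eqxx; split=> //.
  exists (st n : nat); last by rewrite trace_state xE.
  by rewrite fld_final; apply: map_f; rewrite mem_enum.
- move=> x y; rewrite ltEord /trace_binary => xy; rewrite xy => /eqP yE.
  have xn : x < n by rewrite -ltnS yE ltn_ord.
  have := tr x xn; rewrite yE => trD.
  exists (trans_code (st x, w x, st y)).
    by rewrite fld_delta; apply: map_f; rewrite mem_enum.
  have [-> -> ->] := fld_trans_code (st x, w x, st y).
  by rewrite !trace_state trace_op /w' xn !eqxx.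
- move=> x i j ji _; rewrite !trace_state !trace_op.
  by split=> -[/eqP-> /eqP eij]; rewrite eij ltnn in ji.
- move=> x c _; rewrite trace_op => /eqP/dec_code_inj[d wx ->{c}]; split.
    (* Fewer decrements than increments precede [x], so the increment with the rank of this
       decrement exists and lies before [x]. *)
    have := dec_inc x d wx => /occ_reach[j jx [wj occj]].
    have jn : j < n.+1 by apply: ltn_trans jx _.
    have [xn wxE] := w'E x d (or_intror wx).
    have w'j : w' j = Inc d by rewrite /w' (ltn_trans jx xn).
    exists (Ordinal jn); rewrite ltEord trace_op /= w'j op_codeE eqxx; split=> //.
    rewrite /trace_binary /= ltnNge (ltnW jx) /=; apply/existsP; exists d.
    by rewrite w'j wx occj !eqxx.
  move=> y z; rewrite !ltEord !trace_op /trace_binary.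
  move=> [yx + /eqP/inc_code_inj[d1 wy d1E]] [zx + /eqP/inc_code_inj[d2 wz d2E]].
  move/val_inj: d1E wy => <- wy; move/val_inj: d2E wz => <- wz.
  rewrite ltnNge (ltnW yx) ltnNge (ltnW zx) /= wx wy wz.
  case/existsP=> c1 /and3P[/eqP[<-] _ /eqP occy].
  case/existsP=> c2 /and3P[/eqP[<-] _ /eqP occz].
  have [_ wyE] := w'E y d (or_introl wy); have [_ wzE] := w'E z d (or_introl wz).
  by apply: val_inj; apply: (@occ_pos_inj _ w (Inc d)); rewrite ?wyE ?wzE ?occy.
- move=> x c _; rewrite trace_op => /eqP/inc_code_inj[d wx ->{c}] y z.
  rewrite !ltEord !trace_op /trace_binary.
  move=> [yx + /eqP/dec_code_inj[d1 wy d1E]] [zx + /eqP/dec_code_inj[d2 wz d2E]].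
  move/val_inj: d1E wy => <- wy; move/val_inj: d2E wz => <- wz.
  rewrite ltnNge (ltnW yx) ltnNge (ltnW zx) /= wx wy wz.
  case/existsP=> c1 /and3P[/eqP[<-] _ /eqP occy].
  case/existsP=> c2 /and3P[/eqP[<-] _ /eqP occz].
  have [_ wyE] := w'E y d (or_intror wy); have [_ wzE] := w'E z d (or_intror wz).
  by apply: val_inj; apply: (@occ_pos_inj _ w (Dec d)); rewrite ?wyE ?wzE -?occy.
- move=> x c; rewrite fld_zero_tested => /mapP[d]; rewrite mem_enum => dR ->{c}.
  rewrite trace_op => /eqP/inc_code_inj[e wx /val_inj eE]; subst e.
  have [xn wxE] := w'E x d (or_introl wx).
  (* The totals agree for a tested counter, so a decrement with the rank of the increment [x]
     exists. *)
  have : occ w (Inc d) x < occ w (Dec d) n.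
    by rewrite -zero // (occ_lt _ xn) // wxE.
  case/occ_reach=> j jn [wj occj].
  have w'j : w' j = Dec d by rewrite /w' jn.
  (* Were [j] before [x], positivity at [j] would give more increments before [j] than before
     [x]. *)
  have xj : x < j.
    rewrite ltnNge leq_eqVlt; apply/negP=> /orP[/eqP jx|jx].
      by move: wx; rewrite -jx w'j.
    have := decs j d jn wj; rewrite occj.
    move/leq_trans/(_ (occ_le w (Inc d) (ltnW jx))).
    by rewrite ltnn.
  exists (Ordinal (ltnW jn : j < n.+1)); rewrite ltEord trace_op /= w'j op_codeE eqxx.
  split=> //; rewrite /trace_binary /= ltnNge (ltnW xj) /=; apply/existsP; exists d.
  by rewrite wx w'j occj !eqxx.
Qed.

End Model.

(** * From a model to a run *)

Lemma order_enumeration (M : structure) :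
  exists n (x : nat -> dom M),
    (forall i j, i <= n -> j <= n -> (x i < x j)%O = (i < j)) /\
    (forall y, exists2 i, i <= n & y = x i).
Proof.
have [d _] := card_gt0P (dom_nonempty M).
pose s := sort <=%O (enum (dom M)).
have size_s : size s = #|dom M|.-1.+1.
  by rewrite size_sort -cardE prednK ?dom_nonempty.
have sorted_s : sorted <%O s by rewrite sort_lt_sorted enum_uniq.
exists #|dom M|.-1, (nth d s); split.
  by move=> i j ilen jlen; rewrite (lt_sorted_ltn_nth d sorted_s) // inE size_s.
move=> y; have ys : y \in s by rewrite mem_sort mem_enum.
by exists (index y s); rewrite ?nth_index // -ltnS -size_s index_mem.
Qed.

Section Trace.
Variables (A : mca_input) (M : structure).
Hypothesis enc : encodes (mca_code A) M.
Variables (n : nat) (x : nat -> dom M).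
Hypothesis x_lt : forall i j, i <= n -> j <= n -> (x i < x j)%O = (i < j).
Hypothesis x_surj : forall y, exists2 i, i <= n & y = x i.

Let x_inj i j : i <= n -> j <= n -> x i = x j -> i = j.
Proof.
move=> ilen jlen xij; apply/eqP; rewrite eqn_leq leqNgt (leqNgt j).
by rewrite -(x_lt jlen ilen) -(x_lt ilen jlen) xij ltxx.
Qed.

(* A successor edge from x (i+1) to x j with j < i would collide at x j with the
   edge from x (j+1) known by induction. *)
Let pred_edge i : i < n -> binary (x i.+1) (x i).
Proof.
elim/ltn_ind: i => i IH lti.
case: (enc_first enc (x i.+1)) => [[y]|[]]; last first.
  by case; exists (x i); rewrite x_lt // ltnW.
have [j jlen ->] := x_surj y; rewrite x_lt // ltnS leq_eqVlt.
case/orP=> [/eqP-> //|ji] Eij.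
have xj : (x j < x j.+1)%O by rewrite x_lt // (ltn_trans ji).
have xi : (x j < x i.+1)%O by rewrite x_lt // ltnS ltnW.
have := enc_succ enc xj (IH j ji (ltn_trans ji lti)) xi Eij.
move/x_inj => /(_ (ltn_trans ji lti) lti) [eij].
by rewrite eij ltnn in ji.
Qed.

(** By [enc_excl] at most one state and one operation hold at an element, so [pick] returns the
    right one whenever there is one. *)
Let st (i : nat) : 'I_(nstates A) :=
  odflt (init (automaton A)) [pick q : 'I_(nstates A) | unary (q + q) (x i)].
Let w (i : nat) : op 'I_(ncounters A) :=
  odflt Skip
    [pick o : op 'I_(ncounters A) | unary (op_code o + op_code o).+1 (x i)].

Let state_uniq (y : dom M) (p q : 'I_(nstates A)) :
  unary (p + p) y -> unary (q + q) y -> p = q.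
Proof.
move=> Sp Sq; apply: val_inj; case: (ltngtP p q) => // lt; exfalso.
  by have [+ _] := enc_excl enc y lt (state_bound q); apply.
by have [+ _] := enc_excl enc y lt (state_bound p); apply.
Qed.

Let op_uniq (y : dom M) (o o' : op 'I_(ncounters A)) :
  unary (op_code o + op_code o).+1 y ->
  unary (op_code o' + op_code o').+1 y -> o = o'.
Proof.
move=> Oo Oo'; apply: (@op_code_inj (ncounters A)).
case: (ltngtP (op_code o) (op_code o')) => // lt; exfalso.
  by have [_ +] := enc_excl enc y lt (op_code_bound o'); apply.
by have [_ +] := enc_excl enc y lt (op_code_bound o); apply.
Qed.

Let stE i q : unary (val q + val q) (x i) -> st i = q.
Proof.
rewrite /st => Sq; case: pickP => [p Sp|/(_ q)]; last by rewrite Sq.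
exact: state_uniq Sp Sq.
Qed.

Let wE i o : unary (op_code o + op_code o).+1 (x i) -> w i = o.
Proof.
rewrite /w => Oo; case: pickP => [o' Oo'|/(_ o)]; last by rewrite Oo.
exact: op_uniq Oo' Oo.
Qed.

Let trans i : i < n ->
  (st i, w i, st i.+1) \in delta (automaton A) /\
  unary (op_code (w i) + op_code (w i)).+1 (x i).
Proof.
move=> lti; have xi : (x i < x i.+1)%O by rewrite x_lt // ltnW.
have [t] := enc_trans enc xi (pred_edge lti).
rewrite fld_delta => /mapP[[[p o] q]]; rewrite mem_enum => tD ->.
have [-> -> ->] := fld_trans_code (p, o, q); move=> [Sp Oo Sq].
by rewrite (stE Sp) (wE Oo) (stE Sq).
Qed.

Let op_holds i o : i < n -> w i = o -> unary (op_code o + op_code o).+1 (x i).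
Proof. by move=> /trans[_ +] <-. Qed.

(** A decrement at [j < a] is matched with an increment before [j], hence before [b] because
    [j <= b]. The slack [a <= b.+1] serves to count a decrement at [b] itself. *)
Let decs_le c a b : a <= n -> b <= n -> a <= b.+1 ->
  occ w (Dec c) a <= occ w (Inc c) b.
Proof.
move=> an bn ab.
apply: (@occ_leq_inj _ w _ _ _ _ (fun j k => (k < j) && binary (x k) (x j))).
  move=> j ja wj; have jn := leq_trans ja an.
  have [[y [yx Ey Iy]] _] := enc_dec enc (inc_bound c) (op_holds jn wj).
  have [k kn yE] := x_surj y; subst y; rewrite (x_lt kn (ltnW jn)) in yx.
  exists k; first by rewrite -ltnS (leq_trans _ ab) // (leq_ltn_trans yx).
  by rewrite yx Ey; split=> //; apply: (wE (o := Inc c)).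
move=> j j' k ja j'a wj wj' kb wk /andP[kj Ej] /andP[kj' Ej'].
have [jn j'n kn] := And3 (leq_trans ja an) (leq_trans j'a an) (leq_trans kb bn).
apply: (x_inj (ltnW jn) (ltnW j'n)).
apply: (enc_inc enc (inc_bound c) (op_holds kn wk)); split => //.
- by rewrite x_lt // ltnW.
- exact: (op_holds jn wj).
- by rewrite x_lt // ltnW.
- exact: (op_holds j'n wj').
Qed.

(** Increments are sent to their matching decrements. These lie strictly before [n], because the
    maximal element skips. *)
Let incs_le c : c \in zero_tested (automaton A) ->
  occ w (Inc c) n <= occ w (Dec c) n.
Proof.
move=> cR.
have last_skip : unary (skip_code + skip_code).+1 (x n).
  case: (enc_last enc (x n)) => [[y]|[]//].
  by have [j jn ->] := x_surj y; rewrite x_lt // ltnNge jn.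
apply: (@occ_leq_inj _ w _ _ _ _ (fun j k => (j < k) && binary (x j) (x k))).
  move=> j jn wj.
  have cR' : val c \in CodeSeq.decode (fld (mca_code A) 2).
    by rewrite fld_zero_tested; apply: map_f; rewrite mem_enum.
  have [y [xy Ey Dy]] := enc_zero enc cR' (op_holds jn wj).
  have [k kn yE] := x_surj y; subst y; rewrite (x_lt (ltnW jn) kn) in xy.
  exists k; last by rewrite xy Ey; split=> //; apply: (wE (o := Dec c)).
  rewrite ltn_neqAle kn andbT; apply/eqP=> kE; rewrite kE in Dy.
  by have := @op_uniq _ (Dec c) Skip Dy last_skip.
move=> j j' k jn j'n wj wj' kn wk /andP[jk Ej] /andP[jk' Ej'].
apply: (x_inj (ltnW jn) (ltnW j'n)).
have [_ uniq] := enc_dec enc (inc_bound c) (op_holds kn wk).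
apply: uniq; split => //.
- by rewrite x_lt // ltnW.
- exact: (op_holds jn wj).
- by rewrite x_lt // ltnW.
- exact: (op_holds j'n wj').
Qed.

Lemma encodes_trace : exists n st w, valid_trace (automaton A) n st w.
Proof.
exists n, st, w; split.
- apply: stE; case: (enc_first enc (x 0)) => [[y]|[_]]; last by rewrite fld_init.
  by have [j jn ->] := x_surj y; rewrite x_lt.
- by move=> i /trans[].
- case: (enc_last enc (x n)) => [[y]|[_ [q]]].
    by have [j jn ->] := x_surj y; rewrite x_lt // ltnNge jn.
  rewrite fld_final => /mapP[p]; rewrite mem_enum => pF -> Sp.
  by rewrite (stE Sp).
(* Counting up to [i.+1] includes the decrement at [i], which yields the strict inequality. *)
- move=> i c lti wi; have := @decs_le c i.+1 i lti (ltnW lti) (leqnn _).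
  by rewrite occS wi eqxx addn1.
- move=> c cR; apply/eqP; rewrite eqn_leq incs_le //=.
  exact: decs_le.
Qed.

End Trace.

Lemma mca_nonempty_phi (A : mca_input) :
  mca_nonempty A <->
  finitely_satisfiable (exist _ (phi (mca_code A)) (phi_closed (mca_code A))).
Proof.
split=> [/accepting_run_trace[n [st [w valid]]]|[M /phi_encodes enc]].
  by exists (trace_model n st w); apply/phi_encodes/trace_model_encodes.
have [n [x [x_lt x_surj]]] := order_enumeration M.
have [n' [st [w valid]]] := encodes_trace enc x_lt x_surj.
exact: trace_accepting_run valid.
Qed.

Theorem theorem5p4 :
  many_one_reducible mca_code sentence_code mca_nonempty finitely_satisfiable.
Proof.
exists (fun A => exist _ (phi (mca_code A)) (phi_closed (mca_code A)));
  last exact: mca_nonempty_phi.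
exists (fun v : 1.-tuple nat => formula_code (phi (head 0 v))) => //.
exact: (rform_phi (rf_head 0)).
Qed.
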